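(* Let $S\in\mathbb{R}^{n\times s}$ be a snapshot matrix, let $\gamma^a,\gamma^b\in\mathbb{R}^s$ be two weight vectors with $\Gamma^a=\mathrm{diag}(\gamma^a_1,\dots,\gamma^a_s)$ and $\Gamma^b=\mathrm{diag}(\gamma^b_1,\dots,\gamma^b_s)$, and let $\Theta^a,\Theta^b\in\mathbb{R}^{n\times n}$ be symmetric positive semidefinite matrices with $\Theta^a=\Theta^b+\Delta$. Let $\mathcal{U}^a=\mathcal{U}_y^{\Theta^a}(S,\gamma^a)$ and $\mathcal{U}^b=\mathcal{U}_y^{\Theta^b}(S,\gamma^b)$ be the associated $y$-dimensional POD subspaces. If the matrix $S\Gamma^a$ has full column rank, then $$d(\mathcal{U}^a,\mathcal{U}^b)\le\frac{\kappa(S\Gamma^a)\,\kappa\big([\Gamma^a]^{-1}\Gamma^bV^b\big)\Big(\big\|(\Gamma^b+\Gamma^a)(\Gamma^b-\Gamma^a)[\Gamma^a]^{-1}S^T\Theta^bS\Gamma^a\big\|_2+\|\Delta\|_2\,\|S\Gamma^a\|_2^2\Big)}{\mathrm{abssep}(\Lambda^a_\perp,\Lambda^b)}.$$ Here $V^b\in\mathbb{R}^{s\times y}$ (orthonormal columns) and $\Lambda^b\in\mathbb{R}^{y\times y}$ (diagonal) denote the first $y$ eigenvectors and eigenvalues of $\Gamma^bS^T\Theta^bS\Gamma^b$, eigenvalues being ordered in descending magnitude, and $\Lambda^a_\perp$ denotes the diagonal matrix of the eigenvalues associated with the orthogonal complement of the invariant subspace spanned by the first $y$ eigenvectors of $\Gamma^aS^T\Theta^aS\Gamma^a$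 (i.e. of its remaining $s-y$ eigenvalues, with the same ordering).
   Context: Distance between subspaces: $d(\mathcal{U},\mathcal{V})=\max_{u\in\mathcal{U},\,\|u\|=1}\min_{v\in\mathcal{V}}\|u-v\|=\sin(\theta_{\max})$, with $\theta_{\max}$ the largest principal angle between $\mathcal{U}$ and $\mathcal{V}$. $\kappa(M)$ is the 2-norm condition number of $M$ (largest over smallest singular value, also for rectangular full-column-rank $M$). The absolute separation is $\mathrm{abssep}(\Lambda_1,\Lambda_2)=\min_{\|Z\|_2=1}\|\Lambda_1Z-Z\Lambda_2\|_2$, the minimum over matrices $Z$ of compatible size; the bound is to be read with a nonzero denominator. POD subspace: for snapshots $S=[s_1\ \cdots\ s_s]\in\mathbb{R}^{n\times s}$, weights $\gamma\in\mathbb{R}^s$ and symmetric positive semidefinite $\Theta$, the $y$-dimensional POD subspace is $$\mathcal{U}_y^\Theta(S,\gamma)=\arg\min_{\mathcal{A}}\sum_{i=1}^s\|(I-P_\Theta^{\mathcal{A}})(\gamma_is_i)\|_\Theta^2$$ over $y$-dimensional subspaces $\mathcal{A}$ of $\mathbb{R}^n$, where $\|x\|_\Theta=\sqrt{x^T\Theta x}$ and, for $\mathcal{A}=\mathrm{range}(W)$ with $W$ of full column rank and $\Theta=(\Theta^{1/2})^T\Theta^{1/2}$, $P_\Theta^{\mathcal{A}}=W(\Theta^{1/2}W)^+\Theta^{1/2}$ ($+$ denotes the Moore–Penrose pseudoinverse). It is given algebraically as the range of $S\Gamma V\Lambda^{-1/2}$, where $\Gamma=\mathrm{diag}(\gamma_1,\dots,\gamma_s)$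 and $V\in\mathbb{R}^{s\times y}$, $\Lambda\in\mathbb{R}^{y\times y}$ contain the first $y$ orthonormal eigenvectors and (diagonal) eigenvalues of $\Gamma S^T\Theta S\Gamma$, ordered by decreasing magnitude; these first $y$ eigenvalues are assumed positive so that the basis is defined. The eigenvectors used for $\mathcal{U}^b$ are the $V^b$ of the claim, and likewise the first $y$ eigenvectors of $\Gamma^aS^T\Theta^aS\Gamma^a$ are those used for $\mathcal{U}^a$. *)

(* Defs.v *)
From mathcomp Require Import all_boot all_order all_algebra.
From mathcomp Require Import all_classical all_reals ereal.
From mathcomp Require Import ring lra.

Set Implicit Arguments.
Unset Strict Implicit.
Unset Printing Implicit Defensive.

Import Order.TTheory GRing.Theory Num.Theory.
Local Open Scope classical_set_scope.
Local Open Scope ring_scope.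

Definition norm2 (R : realType) n (x : 'cV[R]_n) : R :=
  Num.sqrt (\sum_i x i 0 ^+ 2).

Definition specnorm (R : realType) m n (M : 'M[R]_(m, n)) : R :=
  sup [set norm2 (M *m x) | x in [set x : 'cV[R]_n | norm2 x = 1]].

(* These are the singular values of M when m >= n; for m < n they would
   contain extra zeros. *)
Definition singular_values (R : realType) m n (M : 'M[R]_(m, n)) : set R :=
  [set sigma | 0 <= sigma /\ eigenvalue (M^T *m M) (sigma ^+ 2)].

Definition kappa (R : realType) m n (M : 'M[R]_(m, n)) : R :=
  sup (singular_values M) / inf (singular_values M).

(* In the extended reals, so that the minimum is +oo (and dividing by it gives
   0) when no Z has norm 1, that is when one of the two matrices is 0 x 0. *)
Definition abssep (R : realType) p q (L1 : 'M[R]_p) (L2 : 'M[R]_q) : \bar R :=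
  ereal_inf [set (specnorm (L1 *m Z - Z *m L2))%:E
            | Z in [set Z : 'M[R]_(p, q) | specnorm Z = 1]].

Definition mxrange (R : realType) m n (W : 'M[R]_(m, n)) : {vspace 'cV[R]_m} :=
  limg (linfun (mulmx W : 'cV[R]_n -> 'cV[R]_m)).

Definition subspace_dist (R : realType) n (U V : {vspace 'cV[R]_n}) : R :=
  sup [set inf [set norm2 (u - v) | v in [set v | v \in V]]
      | u in [set u | u \in U /\ norm2 u = 1]].

Definition psdmx (R : realType) n (Th : 'M[R]_n) : Prop :=
  Th^T = Th /\ forall x : 'cV[R]_n, 0 <= (x^T *m Th *m x) 0 0.

Definition thnorm (R : realType) n (Th : 'M[R]_n) (x : 'cV[R]_n) : R :=
  Num.sqrt ((x^T *m Th *m x) 0 0).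

Definition penrose (R : realType) m n (A : 'M[R]_(m, n)) (X : 'M[R]_(n, m)) :=
  [/\ A *m X *m A = A, X *m A *m X = X,
      (A *m X)^T = A *m X & (X *m A)^T = X *m A].

Definition mp_pinv (R : realType) m n (A : 'M[R]_(m, n)) : 'M[R]_(n, m) :=
  xget 0 [set X | penrose A X].

(* T stands for Theta^{1/2}, a matrix with T^T *m T = Theta. *)
Definition th_proj (R : realType) n y (T : 'M[R]_n) (W : 'M[R]_(n, y))
    : 'M[R]_n :=
  W *m mp_pinv (T *m W) *m T.

Definition pod_error (R : realType) n s y (Th T : 'M[R]_n) (S : 'M[R]_(n, s))
    (g : 'rV[R]_s) (W : 'M[R]_(n, y)) : R :=
  \sum_(i < s) thnorm Th ((1%:M - th_proj T W) *m (g 0 i *: col i S)) ^+ 2.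

(* U is one of the y-dimensional minimizers of the POD error: there may be
   several when Theta is singular or eigenvalues are repeated. The
   y-dimensional competitors are the ranges of the W' of rank y. *)
Definition pod_minimizer (R : realType) n s (y : nat) (Th : 'M[R]_n)
    (S : 'M[R]_(n, s)) (g : 'rV[R]_s) (U : {vspace 'cV[R]_n}) : Prop :=
  \dim U = y /\
  forall (T : 'M[R]_n) (W W' : 'M[R]_(n, y)), T^T *m T = Th ->
    mxrange W = U -> \rank W' = y ->
    pod_error Th T S g W <= pod_error Th T S g W'.

Definition pod_gram (R : realType) n s (Th : 'M[R]_n) (S : 'M[R]_(n, s))
    (g : 'rV[R]_s) : 'M[R]_s :=
  diag_mx g *m S^T *m Th *m S *m diag_mx g.

(* [V Vp] is a full orthonormal eigenbasis of A, ordered by decreasing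
   magnitude of the eigenvalues, with V its first y vectors. *)
Definition eigen_split (R : realType) s y (A : 'M[R]_s)
    (V : 'M[R]_(s, y)) (lam : 'rV[R]_y)
    (Vp : 'M[R]_(s, s - y)) (lamp : 'rV[R]_(s - y)) : Prop :=
  let Q := row_mx V Vp in let l := row_mx lam lamp in
  [/\ Q^T *m Q = 1%:M, A *m Q = Q *m diag_mx l
    & forall i j : 'I_(y + (s - y)), (i <= j)%N -> `|l 0 j| <= `|l 0 i| ].

Definition pod_basis (R : realType) n s y (S : 'M[R]_(n, s)) (g : 'rV[R]_s)
    (V : 'M[R]_(s, y)) (lam : 'rV[R]_y) : 'M[R]_(n, y) :=
  S *m diag_mx g *m V *m diag_mx (\row_j (Num.sqrt (lam 0 j))^-1).

Lemma gram_diag (R : realType) m n (A : 'M[R]_(m, n)) j :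
  (A^T *m A) j j = \sum_i A i j ^+ 2.
Proof. by rewrite mxE; apply: eq_bigr => i _; rewrite !mxE expr2. Qed.

Lemma gram_ge0 (R : realType) m n (A : 'M[R]_(m, n)) j : 0 <= (A^T *m A) j j.
Proof. by rewrite gram_diag sumr_ge0 // => i _; rewrite sqr_ge0. Qed.

Lemma gram_eq0 (R : realType) m n (A : 'M[R]_(m, n)) : A^T *m A = 0 -> A = 0.
Proof.
move=> A0; apply/matrixP => i j; have := gram_diag A j.
rewrite A0 mxE => /esym/eqP; rewrite psumr_eq0; last by move=> *; rewrite sqr_ge0.
by move=> /allP/(_ i (mem_index_enum _))/=; rewrite sqrf_eq0 mxE => /eqP.
Qed.

Lemma gram_unit (R : realType) m n (A : 'M[R]_(m, n)) :
  \rank A = n -> A^T *m A \in unitmx.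
Proof.
move=> rA; rewrite -row_free_unit -kermx_eq0; apply/eqP.
set K := kermx _; have K0 : K *m A^T = 0.
  apply: trmx_inj; rewrite trmx0; apply: gram_eq0.
  by rewrite trmxK -mulmxA trmx_mul trmxK !mulmxA -(mulmxA K) mulmx_ker mul0mx.
apply/eqP; rewrite -(@mulmx_free_eq0 _ _ _ _ _ A^T) ?K0 //.
by rewrite /row_free mxrank_tr rA.
Qed.

Lemma mp_pinvP (R : realType) m n (A : 'M[R]_(m, n)) : penrose A (mp_pinv A).
Proof.
suff [X AX] : exists X, penrose A X by apply: (@xgetPex _ 0 [set X | penrose A X]); exists X.
have [r [C [B [-> rC rB]]]] : exists r (C : 'M[R]_(m, r)) (B : 'M[R]_(r, n)),
    [/\ A = C *m B, \rank C = r & \rank B^T = r].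
  exists (\rank A), (col_base A), (row_base A); rewrite mulmx_base mxrank_tr.
  split=> //; last exact/eqP/row_base_free.
  by apply/eqP; have := col_base_full A.
have uC := gram_unit rC; have := gram_unit rB; rewrite trmxK => uB.
pose H := C^T *m C; pose G := B *m B^T.
exists (B^T *m invmx G *m invmx H *m C^T).
have HT : (invmx H)^T = invmx H by rewrite trmx_inv trmx_mul trmxK.
have GT : (invmx G)^T = invmx G by rewrite trmx_inv trmx_mul trmxK.
have AX : C *m B *m (B^T *m invmx G *m invmx H *m C^T) = C *m invmx H *m C^T.
  by rewrite !mulmxA -(mulmxA C B) -/G -(mulmxA C G) mulmxV // mulmx1.
have XA : B^T *m invmx G *m invmx H *m C^T *m (C *m B) = B^T *m invmx G *m B.
  by rewrite !mulmxA -(mulmxA _ C^T C) -/H -(mulmxA _ _ H) mulVmx // mulmx1.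
split.
- by rewrite AX !mulmxA -(mulmxA _ C^T C) -/H -(mulmxA _ _ H) mulVmx // mulmx1.
- by rewrite XA !mulmxA -(mulmxA _ B B^T) -/G -(mulmxA _ _ G) mulVmx // mulmx1.
- by rewrite AX !trmx_mul trmxK HT mulmxA.
- by rewrite XA !trmx_mul trmxK GT mulmxA.
Qed.

Definition fit (R : realType) n y (T : 'M[R]_n) (W : 'M[R]_(n, y)) : 'M[R]_n :=
  T *m W *m mp_pinv (T *m W).

Lemma fit_idem (R : realType) n y (T : 'M[R]_n) (W : 'M[R]_(n, y)) :
  (fit T W)^T *m fit T W = fit T W.
Proof.
have [p1 p2 p3 p4] := mp_pinvP (T *m W).
by rewrite /fit p3 mulmxA p1.
Qed.

Lemma mxrange_mem (R : realType) m n (W : 'M[R]_(m, n)) (x : 'cV[R]_n) :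
  W *m x \in mxrange W.
Proof. by rewrite -[W *m x](lfunE (mulmx W)) memv_img ?memvf. Qed.

Lemma mxrange_factor (R : realType) m n p (W : 'M[R]_(m, n)) (W0 : 'M[R]_(m, p)) :
  (mxrange W0 <= mxrange W)%VS -> exists C, W0 = W *m C.
Proof.
move=> sub.
have /choice[f fP] : forall j, exists x : 'cV[R]_n, col j W0 = W *m x.
  move=> j; have : col j W0 \in mxrange W.
    by apply: (subvP sub); rewrite colE mxrange_mem.
  by case/memv_imgP=> x _; rewrite lfunE => ->; exists x.
exists (\matrix_(i, j) f j i 0); apply/matrixP => i j.
have /colP/(_ i) := fP j; rewrite !mxE => ->.
by apply: eq_bigr => k _; rewrite !mxE.
Qed.

Lemma pod_errorE (R : realType) n s y (Th T : 'M[R]_n) (S : 'M[R]_(n, s))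
    (g : 'rV[R]_s) (W : 'M[R]_(n, y)) (B := T *m S *m diag_mx g) :
  T^T *m T = Th ->
  pod_error Th T S g W = \tr (B^T *m B) - \tr (B^T *m fit T W *m B).
Proof.
move=> TT; have QQ := fit_idem T W; set Q := fit T W in QQ *.
have QT : Q^T = Q by rewrite -QQ trmx_mul trmxK.
pose F := (1%:M - Q) *m B.
have FE : F^T *m F = B^T *m B - B^T *m Q *m B.
  have Q2 : Q *m Q = Q by rewrite -{1}QT.
  have PP : (1%:M - Q)^T *m (1%:M - Q) = 1%:M - Q.
    rewrite [(_ - _)^T]linearB /= trmx1 QT.
    by rewrite mulmxBl mul1mx mulmxBr mulmx1 Q2 subrr subr0.
  by rewrite /F trmx_mul mulmxA -(mulmxA B^T _ (1%:M - Q)) PP mulmxBr mulmx1 mulmxBl.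
rewrite -raddfB /= -FE; apply: eq_bigr => i _.
set x := _ *m (_ *: _).
have xE : T *m x = F *m delta_mx i (0 : 'I_1).
  rewrite /x /F /B mulmxA mulmxBr mulmx1 /th_proj !mulmxA -/Q.
  rewrite -[T *m W *m _]/Q -{1}[T]mul1mx -mulmxBl -!mulmxA; congr (_ *m (_ *m _)).
  rewrite colE scalemxAr; congr (_ *m _).
  apply/colP => k; rewrite mul_diag_mx !mxE.
  by case: (k =P i) => [->|]; rewrite //= !mulr0.
clearbody x F.
have xx : (x^T *m Th *m x) = (F *m delta_mx i (0 : 'I_1))^T *m (F *m delta_mx i 0).
  by rewrite -xE -TT trmx_mul !mulmxA.
rewrite /thnorm sqr_sqrtr; last by rewrite xx gram_ge0.
rewrite xx trmx_mul trmx_delta -mulmxA (mulmxA F^T) -colE -rowE.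
by rewrite !mxE.
Qed.

Lemma proj_diag_le1 (R : realType) n (G : 'M[R]_n) j : G^T *m G = G -> G j j <= 1.
Proof.
move=> GG; have := gram_diag G j; rewrite GG (bigD1 j) //= => E.
have : G j j ^+ 2 <= G j j.
  by rewrite {2}E lerDl sumr_ge0 // => i _; rewrite sqr_ge0.
move=> h; nra.
Qed.

Lemma fit_tr (R : realType) n y (T : 'M[R]_n) (W : 'M[R]_(n, y)) :
  \tr (fit T W) <= y%:R.
Proof.
have [p1 p2 p3 p4] := mp_pinvP (T *m W).
rewrite /fit; move: (T *m W) (mp_pinv _) p1 p2 p3 p4 => A X p1 p2 p3 p4.
rewrite mxtrace_mulC /mxtrace -[y in y%:R]card_ord -sumr_const.
apply: ler_sum => i _; apply: proj_diag_le1.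
by rewrite p4 -mulmxA (mulmxA A) p1.
Qed.

Lemma ky_fan (R : realType) n y k (Q : 'M[R]_n) (M : 'M[R]_(n, y + k))
    (lam : 'rV[R]_y) (lamp : 'rV[R]_k) :
  Q^T *m Q = Q -> \tr Q <= y%:R -> M^T *m M = diag_mx (row_mx lam lamp) ->
  (forall i j, lamp 0 j <= lam 0 i) ->
  \tr (M^T *m Q *m M) <= \sum_i lam 0 i.
Proof.
move=> QQ trQ MM le_l.
have QT : Q^T = Q by rewrite -QQ trmx_mul trmxK.
have Q2 : Q *m Q = Q by rewrite -{1}QT.
move lE : (row_mx lam lamp) MM => l MM.
have l0 i : 0 <= l 0 i.
  by have := gram_ge0 M i; rewrite MM !mxE eqxx mulr1n.
pose w i := (M^T *m Q *m M) i i.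
have w0 i : 0 <= w i.
  have -> : w i = ((Q *m M)^T *m (Q *m M)) i i.
    by rewrite /w trmx_mul mulmxA -(mulmxA M^T _ Q) QQ.
  exact: gram_ge0.
have wl i : w i <= l 0 i.
  have := gram_ge0 ((1%:M - Q) *m M) i.
  have -> : ((1%:M - Q) *m M)^T *m ((1%:M - Q) *m M) = M^T *m M - M^T *m Q *m M.
    have PP : (1%:M - Q)^T *m (1%:M - Q) = 1%:M - Q.
      rewrite [(_ - _)^T]linearB /= trmx1 QT.
      by rewrite mulmxBl mul1mx mulmxBr mulmx1 Q2 subrr subr0.
    by rewrite trmx_mul mulmxA -(mulmxA M^T _ (1%:M - Q)) PP mulmxBr mulmx1 mulmxBl.
  by rewrite MM !mxE eqxx mulr1n subr_ge0 /w mxE.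
pose c i := w i / l 0 i.
have wc i : w i = l 0 i * c i.
  rewrite /c; have [l_0|l_n0] := eqVneq (l 0 i) 0; last by field.
  by apply/eqP; rewrite l_0 mul0r eq_le w0 -[X in _ <= X]l_0 wl.
have c0 i : 0 <= c i by rewrite divr_ge0.
have c1 i : c i <= 1.
  rewrite /c; have [->|l_n0] := eqVneq (l 0 i) 0; first by rewrite invr0 mulr0.
  by rewrite ler_pdivrMr ?mul1r // lt_def l_n0 l0.
pose d := \row_i (Num.sqrt (l 0 i))^-1.
pose N := M *m diag_mx d.
have d2 i : d 0 i * d 0 i = (l 0 i)^-1.
  by rewrite mxE -invfM -expr2 sqr_sqrtr.
have NQN i : (N^T *m Q *m N) i i = c i.
  rewrite /N trmx_mul tr_diag_mx -!mulmxA mul_diag_mx mxE !mulmxA mul_mx_diag mxE.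
  by rewrite mulrCA d2.
have cy : \sum_i c i <= y%:R.
  apply: le_trans trQ.
  have -> : \sum_i c i = \tr (Q *m (N *m N^T)).
    rewrite -(eq_bigr _ (fun i _ => NQN i)) -/(mxtrace _).
    by rewrite mulmxA -mulmxA mxtrace_mulC mulmxA.
  pose P := N *m N^T.
  have PT : P^T = P by rewrite trmx_mul trmxK.
  have NN : N^T *m N = diag_mx (\row_i (l 0 i != 0)%:R).
    rewrite /N trmx_mul tr_diag_mx !mulmxA -(mulmxA _ _ M) MM !mulmx_diag.
    congr diag_mx; apply/rowP => i.
    transitivity (d 0 i * l 0 i * d 0 i); first by rewrite !mxE.
    rewrite mulrAC d2 mxE; have [->|l_n0] := eqVneq (l 0 i) 0; first by rewrite mulr0.
    by rewrite mulVf.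
  have P2 : P *m P = P.
    rewrite /P mulmxA -(mulmxA N) NN; congr (_ *m _).
    rewrite /N -mulmxA mulmx_diag; congr (_ *m diag_mx _); apply/rowP => i.
    rewrite !mxE; case: eqP => [->|_] /=; last by rewrite mulr1.
    by rewrite sqrtr0 invr0 mul0r.
  rewrite -subr_ge0 -raddfB /= -/P; clearbody P.
  have -> : \tr (Q - Q *m P) = \tr (((1%:M - P) *m Q)^T *m ((1%:M - P) *m Q)).
    have PP : (1%:M - P)^T *m (1%:M - P) = 1%:M - P.
      rewrite [(_ - _)^T]linearB /= trmx1 PT.
      by rewrite mulmxBl mul1mx mulmxBr mulmx1 P2 subrr subr0.
    rewrite trmx_mul mulmxA -(mulmxA Q^T _ (1%:M - P)) PP mxtrace_mulC mulmxA QT Q2.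
    by rewrite mulmxBr mulmx1.
  by apply: sumr_ge0 => i _; apply: gram_ge0.
rewrite /mxtrace -/w (eq_bigr _ (fun i _ => wc i)) big_split_ord /=.
move: cy; rewrite big_split_ord /=.
pose mu := \big[Num.max/0]_j lamp 0 j.
have mu0 : 0 <= mu by apply: bigmax_ge_id.
have mulam i : mu <= lam 0 i.
  apply: bigmax_le => [|j _]; last exact: le_l.
  by have := l0 (lshift _ i); rewrite -lE row_mxEl.
have lampmu j : lamp 0 j <= mu by apply: le_bigmax.
set A := \sum_(i < y) _; set C := \sum_(i < k) _ => AC.
have h1 : \sum_(i < k) l 0 (rshift y i) * c (rshift y i) <= mu * C.
  rewrite mulr_sumr; apply: ler_sum => i _; rewrite -lE row_mxEr.
  by apply: ler_wpM2r.
have h2 : mu * (y%:R - A) <= \sum_i lam 0 i - \sum_(i < y) l 0 (lshift k i) * c (lshift k i).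
  rewrite -[y in y%:R]card_ord -sumr_const -!sumrB mulr_sumr; apply: ler_sum => i _.
  have := mulam i; have := c1 (lshift k i); rewrite -lE row_mxEl => h h'.
  by rewrite -[leRHS](_ : lam 0 i * (1 - c (lshift k i)) = _); [apply: ler_wpM2r; rewrite ?subr_ge0|ring].
have h3 : mu * C <= mu * (y%:R - A) by apply: ler_wpM2l => //; lra.
lra.
Qed.

(* Every choice of leading eigenvectors gives a minimizer of the POD error: a
   space given as mxrange (pod_basis _ _ _ _) always is a pod_minimizer. *)
Lemma pod_basis_minimizer (R : realType) n s y (Th : 'M[R]_n) (S : 'M[R]_(n, s))
    (g : 'rV[R]_s) (V : 'M[R]_(s, y)) lam Vp lamp :
  eigen_split (pod_gram Th S g) V lam Vp lamp ->
  (forall j, 0 < lam 0 j) ->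
  pod_minimizer y Th S g (mxrange (pod_basis S g V lam)).
Proof.
move=> [QQ AQ sorted] lam0; set W0 := pod_basis S g V lam.
pose D := diag_mx (\row_j (Num.sqrt (lam 0 j))^-1).
have VV : V^T *m V = 1%:M.
  move: QQ; rewrite tr_row_mx mul_col_row scalar_mx_block => /eq_block_mx[-> *].
  by [].
have AV : pod_gram Th S g *m V = V *m diag_mx lam.
  move: AQ; rewrite diag_mx_row mul_mx_row mul_row_block !mulmx0 addr0 add0r.
  by case/eq_row_mx.
have Dl : D *m diag_mx lam *m D = 1%:M.
  rewrite !mulmx_diag -diag_const_mx; congr diag_mx; apply/rowP => i; rewrite !mxE.
  by rewrite mulrAC -invfM -expr2 sqr_sqrtr ?mulVf ?gt_eqF // ltW.
have W0W0 : W0^T *m Th *m W0 = 1%:M.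
  rewrite -Dl /W0 /pod_basis -/D !trmx_mul !tr_diag_mx -/D.
  have -> : D *m (V^T *m (diag_mx g *m S^T)) *m Th *m (S *m diag_mx g *m V *m D)
     = D *m (V^T *m (pod_gram Th S g *m V)) *m D by rewrite /pod_gram !mulmxA.
  by rewrite AV mulmxA VV mul1mx.
split.
  clearbody W0; rewrite /mxrange limg_dim_eq ?dimvf /dim /= ?muln1 //.
  rewrite capfv; apply/eqP; apply/lker0P => x z; rewrite !lfunE /= => /(congr1 (mulmx (W0^T *m Th))).
  by rewrite !mulmxA W0W0 !mul1mx.
move=> T W W' TT rW _.
pose B := T *m S *m diag_mx g.
have BB : B^T *m B = pod_gram Th S g.
  by rewrite /B !trmx_mul tr_diag_mx /pod_gram -TT !mulmxA.
have ys : (y <= s)%N.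
  by apply: leq_trans (mulmx1_min QQ); rewrite leq_addr.
rewrite !pod_errorE // -/B lerD2l lerN2.
pose M := B *m row_mx V Vp.
have MM : M^T *m M = diag_mx (row_mx lam lamp).
  by rewrite /M trmx_mul mulmxA -(mulmxA _ B^T) BB -mulmxA AQ mulmxA QQ mul1mx.
have QQ' : row_mx V Vp *m (row_mx V Vp)^T = 1%:M.
  have gen p (E : 'M[R]_(s, p)) : p = s -> E^T *m E = 1%:M -> E *m E^T = 1%:M.
    by move=> e; subst p; exact: mulmx1C.
  by apply: gen QQ; rewrite subnKC.
have trE Q : \tr (B^T *m Q *m B) = \tr (M^T *m Q *m M).
  have -> : M^T *m Q *m M = (row_mx V Vp)^T *m (B^T *m Q *m B *m row_mx V Vp).
    by rewrite /M trmx_mul !mulmxA.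
  by rewrite [RHS]mxtrace_mulC -(mulmxA _ (row_mx V Vp)) QQ' mulmx1.
rewrite !trE; apply: (@le_trans _ _ (\sum_i lam 0 i)).
  apply: ky_fan MM _; [exact: fit_idem | exact: fit_tr | move=> i j].
  have := sorted (lshift _ i) (rshift _ j) _; rewrite row_mxEl row_mxEr.
  rewrite (gtr0_norm (lam0 i)) => h; apply: le_trans (ler_norm _) (h _).
  by rewrite /= ltnW // ltn_addr.
have [C W0E] : exists C, W0 = W *m C by apply: mxrange_factor; rewrite rW.
have [p1 _ _ _] := mp_pinvP (T *m W).
have QM : fit T W *m (B *m V) = B *m V.
  have BVD : B *m V *m D = T *m W0 by rewrite /B /W0 /pod_basis !mulmxA.
  have QD : fit T W *m (B *m V *m D) = B *m V *m D.
    by rewrite BVD W0E (mulmxA T) (mulmxA (fit T W)) /fit p1.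
  have := congr1 (fun X => X *m (diag_mx lam *m D)) QD.
  have DD : D *m (diag_mx lam *m D) = 1%:M by rewrite mulmxA.
  by rewrite /= -!mulmxA DD !mulmx1.
have -> : \sum_i lam 0 i = \tr ((B *m V)^T *m (B *m V)).
  rewrite trmx_mul mulmxA -(mulmxA _ B^T) BB -mulmxA AV mulmxA VV mul1mx.
  by rewrite mxtrace_diag.
rewrite /M mul_mx_row tr_row_mx mul_col_mx mul_col_row mxtrace_block.
rewrite -(mulmxA (B *m V)^T) QM lerDl; move: (B *m Vp) => X.
rewrite -fit_idem (mulmxA X^T) -trmx_mul -mulmxA.
by apply: sumr_ge0 => i _; exact: gram_ge0.
Qed.

(* Main.v *)
Require Import Defs.
From mathcomp Require Import all_boot all_order all_algebra.
From mathcomp Require Import all_classical all_reals ereal.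
From mathcomp Require Import ring lra.

Set Implicit Arguments.
Unset Strict Implicit.
Unset Printing Implicit Defensive.

Import Order.TTheory GRing.Theory Num.Theory.
Local Open Scope ring_scope.

(** The idea is to see the second POD space as an approximate invariant subspace
    for the first one. Put [M = S *m Ga] and [X = invmx Ga *m Gb *m Vb]. Since
    [S *m Gb *m Vb = M *m X], the second space is the image under [M] of the
    range of [X], and the first one is the image under [M] of the range of
    [Va].

    Let [A] be the first Gram matrix and [Lb] the diagonal matrix of [lamb].
    The eigenvalue equation of the second Gram matrix gives
    [A *m X - X *m Lb = E *m X], where [E] is [M^T *m Delta *m M] minus the
    matrix in the first term of the bound ([pod_residual]); the sum [eta] in
    the bound dominates the norm of [E]. Projected on the complementary
    eigenvectors [Vaperp] of [A], this is a Sylvester equation for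
    [Z = Vaperp^T *m X] ([sylvester_projection]), so the separation bounds [Z]:
    [abssep * specnorm Z <= eta * hiX], with [hiX] the largest singular value
    of [X] ([abssep_inverse]).

    A vector of the second space is [v = M *m X *m b]. It differs from
    [M *m Va *m Va^T *m X *m b], which lies in the first space, by
    [M *m Vaperp *m Z *m b], of norm at most [hiM * specnorm Z * norm2 b],
    whereas [norm2 v >= loM * loX * norm2 b] for the smallest singular values
    [loM] and [loX] of [M] and [X]. The relative error is thus at most the
    asserted bound: the four singular values combine into the two condition
    numbers.

    The link between singular values, defined as square roots of eigenvalues,
    and the inequalities above is [kappa_bounds]; it rests on the fact that the
    supremum of the Rayleigh quotient of a symmetric matrix is an eigenvalue
    ([max_rayleigh_eigenvalue]).

    This estimates the distance from the second space to the first. The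
    asserted bound is for the distance in the opposite direction, which is the
    same because the dimensions agree; [subspace_dist_le] proves the inequality
    that is needed. *)

(** * Euclidean geometry of columns and extremal eigenvalues *)

Definition dot (R : realType) n (x y : 'cV[R]_n) : R := (x^T *m y) 0 0.

Section EuclideanNorm.
Variable R : realType.
Implicit Types m n : nat.

Lemma dotDr n (x y z : 'cV[R]_n) : dot x (y + z) = dot x y + dot x z.
Proof. by rewrite /dot mulmxDr mxE. Qed.

Lemma dotZr n a (x y : 'cV[R]_n) : dot x (a *: y) = a * dot x y.
Proof. by rewrite /dot -scalemxAr mxE. Qed.

Lemma dotC n (x y : 'cV[R]_n) : dot x y = dot y x.
Proof. by rewrite /dot -[in RHS](trmxK x) -trmx_mul [RHS]mxE. Qed.

Lemma dotDl n (x y z : 'cV[R]_n) : dot (x + y) z = dot x z + dot y z.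
Proof. by rewrite dotC dotDr !(dotC z). Qed.

Lemma dotZl n a (x y : 'cV[R]_n) : dot (a *: x) y = a * dot x y.
Proof. by rewrite dotC dotZr dotC. Qed.

Lemma dotNr n (x y : 'cV[R]_n) : dot x (- y) = - dot x y.
Proof. by rewrite -scaleN1r dotZr mulN1r. Qed.

Lemma dotNl n (x y : 'cV[R]_n) : dot (- x) y = - dot x y.
Proof. by rewrite dotC dotNr dotC. Qed.

Lemma dot_adj m n (A : 'M[R]_(m, n)) x y : dot (A *m x) y = dot x (A^T *m y).
Proof. by rewrite /dot trmx_mul mulmxA. Qed.

Lemma dotxx_ge0 n (x : 'cV[R]_n) : 0 <= dot x x.
Proof. exact: gram_ge0. Qed.

Lemma dotxx_eq0 n (x : 'cV[R]_n) : (dot x x == 0) = (x == 0).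
Proof.
apply/eqP/eqP => [x0|->]; last by rewrite /dot mulmx0 mxE.
by apply: gram_eq0; apply/matrixP => i j; rewrite !ord1 [RHS]mxE.
Qed.

Lemma norm2_ge0 n (x : 'cV[R]_n) : 0 <= norm2 x.
Proof. exact: sqrtr_ge0. Qed.

Lemma sqr_norm2 n (x : 'cV[R]_n) : norm2 x ^+ 2 = dot x x.
Proof.
rewrite /norm2 /dot gram_diag sqr_sqrtr //.
by apply: sumr_ge0 => i _; apply: sqr_ge0.
Qed.

Lemma dotxx_norm2_1 n (x : 'cV[R]_n) : dot x x = 1 -> norm2 x = 1.
Proof.
by move=> xx; apply/eqP; rewrite -(@eqrXn2 _ 2) ?norm2_ge0 // sqr_norm2 xx expr1n.
Qed.

Lemma norm2_eq0 n (x : 'cV[R]_n) : (norm2 x == 0) = (x == 0).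
Proof. by rewrite -dotxx_eq0 -sqr_norm2 sqrf_eq0. Qed.

Lemma norm2_0 n : norm2 (0 : 'cV[R]_n) = 0.
Proof. by apply/eqP; rewrite norm2_eq0. Qed.

Lemma norm2Z n a (x : 'cV[R]_n) : norm2 (a *: x) = `|a| * norm2 x.
Proof.
apply/eqP; rewrite -(@eqrXn2 _ 2) ?mulr_ge0 ?norm2_ge0 //.
by rewrite exprMn !sqr_norm2 dotZl dotZr mulrA real_normK ?num_real.
Qed.

Lemma ler_norm2 n m (x : 'cV[R]_n) (y : 'cV[R]_m) c : 0 <= c ->
  (norm2 x <= c * norm2 y) = (dot x x <= c ^+ 2 * dot y y).
Proof.
move=> c0; rewrite -!sqr_norm2 -exprMn ler_sqr //.
  by rewrite nnegrE norm2_ge0.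
by rewrite nnegrE mulr_ge0 ?norm2_ge0.
Qed.

(** The form [B] is only semidefinite: besides the usual inequality
    ([B = 1%:M]) it is applied to a shifted symmetric matrix whose definiteness
    is the very point in question. *)
Lemma psd_cauchy_schwarz n (B : 'M[R]_n) x y :
  B^T = B -> (forall z, 0 <= dot z (B *m z)) ->
  dot x (B *m y) ^+ 2 <= dot x (B *m x) * dot y (B *m y).
Proof.
move=> BT B0.
have E s t : dot (s *: x + t *: y) (B *m (s *: x + t *: y)) =
    s ^+ 2 * dot x (B *m x) + 2 * s * t * dot x (B *m y)
    + t ^+ 2 * dot y (B *m y).
  rewrite mulmxDr -!scalemxAr !dotDr !dotZr !dotDl !dotZl.
  rewrite -[dot y (B *m x)]dotC dot_adj BT; ring.
have := B0 x; have := B0 y; have H s t : 0 <= _ := B0 (s *: x + t *: y).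
move: H => /(fun H s t => eq_ind _ (fun z => 0 <= z) (H s t) _ (E s t)).
set a := dot x (B *m x); set b := dot x _; set c := dot y _ => H c0 a0.
(* The usual choice of coefficients [c], [- b] fails on a vector [y] that is
   isotropic for [B]; then [x] and [y] exchange their roles, and if both are
   isotropic the form at [x - b y] is [- 2 b ^ 2]. *)
have [c_0|c_n0] := eqVneq c 0.
  have [a_0|a_n0] := eqVneq a 0.
    by have := H 1 (- b); rewrite c_0 a_0; nra.
  have a_gt0 : 0 < a by rewrite lt_def a_n0.
  have := H (- b) a; rewrite c_0 => h.
  have {}h : 0 <= a * (0 - b ^+ 2) by nra.
  by move: h; rewrite pmulr_rge0 // mulr0; lra.
have c_gt0 : 0 < c by rewrite lt_def c_n0.
have h : 0 <= c * (a * c - b ^+ 2) by have := H c (- b); nra.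
by move: h; rewrite pmulr_rge0 // subr_ge0.
Qed.

Lemma dot_le_norm2 n (x y : 'cV[R]_n) : dot x y <= norm2 x * norm2 y.
Proof.
have := @psd_cauchy_schwarz n 1%:M x y (trmx1 _ _) _.
rewrite !mul1mx -!sqr_norm2 -exprMn => /(_ _)/= h.
have {}h : dot x y ^+ 2 <= (norm2 x * norm2 y) ^+ 2.
  by apply: h => z; rewrite mul1mx dotxx_ge0.
apply: le_trans (ler_norm _) _.
by rewrite -(@ler_pXn2r _ 2) ?nnegrE ?mulr_ge0 ?norm2_ge0 // real_normK ?num_real.
Qed.

Lemma norm2D n (x y : 'cV[R]_n) : norm2 (x + y) <= norm2 x + norm2 y.
Proof.
rewrite -(@ler_pXn2r _ 2) ?nnegrE ?addr_ge0 ?norm2_ge0 //.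
rewrite sqrrD !sqr_norm2 dotDl !dotDr (dotC y x).
have := dot_le_norm2 x y; lra.
Qed.

Lemma norm2N n (x : 'cV[R]_n) : norm2 (- x) = norm2 x.
Proof. by rewrite -scaleN1r norm2Z normrN1 mul1r. Qed.

(** The Frobenius norm is a bound. *)
Lemma mulmx_bounded m n (A : 'M[R]_(m, n)) :
  exists2 C, 0 <= C & forall x : 'cV[R]_n, norm2 (A *m x) <= C * norm2 x.
Proof.
pose F := \sum_i dot (row i A)^T (row i A)^T.
have F0 : 0 <= F by apply: sumr_ge0 => i _; apply: dotxx_ge0.
exists (Num.sqrt F) => [|x]; first exact: sqrtr_ge0.
rewrite ler_norm2 ?sqrtr_ge0 // sqr_sqrtr // /dot gram_diag mulr_suml.
apply: ler_sum => i _.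
have -> : (A *m x) i 0 = dot (row i A)^T x.
  by rewrite /dot trmxK -row_mul [RHS]mxE.
have := @psd_cauchy_schwarz n 1%:M (row i A)^T x (trmx1 _ _) _.
by rewrite !mul1mx; apply=> z; rewrite mul1mx dotxx_ge0.
Qed.

Lemma unit_vector n : (0 < n)%N -> exists x : 'cV[R]_n, dot x x = 1.
Proof.
case: n => // n _; exists (delta_mx 0 0).
by rewrite /dot trmx_delta mul_delta_mx mxE eqxx.
Qed.

(** Let [t] be the supremum of [dot x (A *m x)] over unit vectors, so that
    [B = t%:M - A] is positive semidefinite. If [B] were invertible, the
    Cauchy-Schwarz inequality of [B] for [x] and [invmx B *m x] would give
    [1 <= dot x (B *m x) * dot (invmx B *m x) x] on unit vectors, so [B] would
    be bounded below by a positive constant, and [t] would not be the least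
    upper bound. *)
Lemma max_rayleigh_eigenvalue n (A : 'M[R]_n) : (0 < n)%N -> A^T = A ->
  exists2 t, eigenvalue A t & forall x, dot x (A *m x) <= t * dot x x.
Proof.
move=> n0 AT.
pose E := [set dot x (A *m x) | x in [set x : 'cV[R]_n | dot x x = 1]]%classic.
have [x1 x1E] := unit_vector n0.
have En0 : (E !=set0)%classic by exists (dot x1 (A *m x1)), x1.
have ubE : has_ubound E.
  have [C C0 HC] := mulmx_bounded A; exists C => _ [x /= xx <-].
  apply: le_trans (dot_le_norm2 _ _) _.
  have n1 := dotxx_norm2_1 xx.
  by have := HC x; rewrite n1 mulr1 mul1r.
set t := sup E.
have tP x : dot x (A *m x) <= t * dot x x.
  have [->|x0] := eqVneq x 0; first by rewrite mulmx0 /dot mulmx0 mxE mulr0.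
  have nx0 : 0 < dot x x by rewrite lt_def dotxx_eq0 x0 dotxx_ge0.
  have k0 : norm2 x != 0 by rewrite norm2_eq0.
  have : dot ((norm2 x)^-1 *: x) (A *m ((norm2 x)^-1 *: x)) <= t.
    apply: ub_le_sup => //; exists ((norm2 x)^-1 *: x) => //=.
    by rewrite dotZl dotZr -sqr_norm2; field.
  rewrite -scalemxAr dotZl dotZr mulrA -invfM -expr2 sqr_norm2 mulrC.
  by rewrite ler_pdivrMr.
exists t => //.
pose B := t%:M - A.
have BE x : dot x (B *m x) = t * dot x x - dot x (A *m x).
  by rewrite /B mulmxBl mul_scalar_mx dotDr dotNr dotZr.
have BT : B^T = B by rewrite [LHS]linearB /= tr_scalar_mx AT.
have B0 x : 0 <= dot x (B *m x) by rewrite BE subr_ge0.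
rewrite /eigenvalue /eigenspace kermx_eq0 row_free_unit -opprB.
rewrite -scaleN1r unitmxZ ?unitrN1 //; apply/negP => uB.
have [C C0 HC] := mulmx_bounded (invmx B).
(* Adding 1 makes the bound on [invmx B] invertible even if [C] is 0. *)
have C1 : 0 < C + 1 by lra.
have V0 : 0 < (C + 1)^-1 by rewrite invr_gt0.
suff : t <= t - (C + 1)^-1 by lra.
apply: ge_sup => // _ [x /= xx <-].
have n1 := dotxx_norm2_1 xx.
have := psd_cauchy_schwarz x (invmx B *m x) BT B0.
rewrite mulmxA mulmxV // mul1mx BE xx mulr1 expr1n.
have : dot (invmx B *m x) x <= C + 1.
  apply: le_trans (dot_le_norm2 _ _) _; rewrite n1 mulr1.
  by have := HC x; rewrite n1; lra.
set d := dot _ x => dC h.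
have h1 : 0 <= t - dot x (A *m x) by have := tP x; rewrite xx; lra.
have h2 : 1 <= (t - dot x (A *m x)) * (C + 1) by nra.
have : (C + 1)^-1 <= t - dot x (A *m x).
  by rewrite -[leLHS]mul1r ler_pdivrMr.
by lra.
Qed.

Lemma min_rayleigh_eigenvalue n (A : 'M[R]_n) : (0 < n)%N -> A^T = A ->
  exists2 t, eigenvalue A t & forall x, t * dot x x <= dot x (A *m x).
Proof.
move=> n0 AT; have := @max_rayleigh_eigenvalue n (- A) n0.
rewrite linearN /= AT => /(_ erefl)[t /eigenvalueP[v vt v0] tP].
exists (- t) => [|x].
  by apply/eigenvalueP; exists v; rewrite // scaleNr -vt mulmxN opprK.
by have := tP x; rewrite mulNmx dotNr mulNr; lra.
Qed.


Implicit Types p q y : nat.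

(** * Injective matrices, spectral norm and condition number *)

Definition mx_inj m n (W : 'M[R]_(m, n)) :=
  forall c : 'cV[R]_n, W *m c = 0 -> c = 0.

Lemma mx_injM m n p (A : 'M[R]_(m, n)) (B : 'M[R]_(n, p)) :
  mx_inj A -> mx_inj B -> mx_inj (A *m B).
Proof. by move=> iA iB c; rewrite -mulmxA => /iA/iB. Qed.

Lemma mx_inj_rank m n (W : 'M[R]_(m, n)) : mx_inj W <-> \rank W = n.
Proof.
split=> [iW|rW c Wc]; last first.
  by rewrite -[c](mulKmx (gram_unit rW)) -mulmxA Wc !mulmx0.
rewrite -mxrank_tr; apply/eqP; rewrite -/(row_free W^T) -kermx_eq0.
rewrite -trmx_eq0; apply/eqP/matrixP => i j.
have /colP/(_ i) : col j (kermx W^T)^T = 0.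
  apply: iW; rewrite colE mulmxA -{1}[W]trmxK -trmx_mul mulmx_ker.
  by rewrite trmx0 mul0mx.
by rewrite !mxE.
Qed.

Lemma unitmx_inj n (A : 'M[R]_n) : A \in unitmx <-> mx_inj A.
Proof.
rewrite mx_inj_rank -row_free_unit /row_free.
by split=> /eqP.
Qed.

Lemma orthonormal_norm2 m n (V : 'M[R]_(m, n)) x :
  V^T *m V = 1%:M -> norm2 (V *m x) = norm2 x.
Proof.
move=> VV; apply/eqP; rewrite -(@eqrXn2 _ 2) ?norm2_ge0 //.
by rewrite !sqr_norm2 dot_adj mulmxA VV mul1mx.
Qed.

(* The two nonnegativity facts hold without boundedness because [sup] and [inf]
   are 0 on sets where they would not be defined. *)
Lemma inf_ge0 (E : set R) : (forall z, E z -> 0 <= z) -> 0 <= inf E.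
Proof.
move=> E0; have [En|nE] := pselect (E !=set0)%classic.
  by apply: lb_le_inf.
by rewrite inf_out // => -[].
Qed.

Lemma sup_ge0 (E : set R) : (forall z, E z -> 0 <= z) -> 0 <= sup E.
Proof.
move=> E0; have [[[z Ez] uE]|nE] := pselect (has_sup E); last by rewrite sup_out.
by apply: le_trans (ub_le_sup uE Ez); apply: E0.
Qed.

Lemma specnorm_ge0 m n (A : 'M[R]_(m, n)) : 0 <= specnorm A.
Proof.
by apply: sup_ge0 => _ [x _ <-]; apply: norm2_ge0.
Qed.

Lemma norm2_mulmx_le m n (A : 'M[R]_(m, n)) x :
  norm2 (A *m x) <= specnorm A * norm2 x.
Proof.
have [->|x0] := eqVneq x 0; first by rewrite mulmx0 !norm2_0 mulr0.
have nx0 : norm2 x != 0 by rewrite norm2_eq0.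
have nx1 : 0 < norm2 x by rewrite lt_def nx0 norm2_ge0.
rewrite -ler_pdivrMr // mulrC -{1}[(norm2 x)^-1]gtr0_norm ?invr_gt0 //.
rewrite -norm2Z scalemxAr; apply: ub_le_sup.
  have [C C0 HC] := mulmx_bounded A; exists C => _ [z /= z1 <-].
  by have := HC z; rewrite z1 mulr1.
by exists ((norm2 x)^-1 *: x); rewrite //= norm2Z gtr0_norm ?invr_gt0 // mulVf.
Qed.

Lemma specnorm_le m n (A : 'M[R]_(m, n)) c : 0 <= c ->
  (forall x, norm2 (A *m x) <= c * norm2 x) -> specnorm A <= c.
Proof.
move=> c0 H; rewrite /specnorm; set E := (X in sup X).
have [[z Ez]|] := pselect (E !=set0)%classic; last first.
  by move=> nE; rewrite sup_out // => -[].
apply: ge_sup; first by exists z.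
by move=> _ [x /= x1 <-]; have := H x; rewrite x1 mulr1.
Qed.

Lemma specnorm_scale_le m n a (A : 'M[R]_(m, n)) :
  0 <= a -> specnorm (a *: A) <= a * specnorm A.
Proof.
move=> a0; apply: specnorm_le => [|x]; first by rewrite mulr_ge0 ?specnorm_ge0.
by rewrite -scalemxAl norm2Z ger0_norm // -mulrA ler_wpM2l ?norm2_mulmx_le.
Qed.

Lemma specnorm_normalize m n (A : 'M[R]_(m, n)) :
  specnorm A != 0 -> specnorm ((specnorm A)^-1 *: A) = 1.
Proof.
move=> A0; have A1 : 0 < specnorm A by rewrite lt_def A0 specnorm_ge0.
apply/eqP; rewrite eq_le; apply/andP; split.
  have V0 : 0 <= (specnorm A)^-1 by rewrite invr_ge0 ltW.
  by apply: le_trans (specnorm_scale_le A V0) _; rewrite mulVf.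
rewrite -(ler_pM2l A1) mulr1.
apply: le_trans (specnorm_scale_le _ (ltW A1)).
by rewrite scalerA mulfV // scale1r.
Qed.

(** A matrix and its transpose have the same norm, because
    [dot (A^T *m x) (A^T *m x) = dot x (A *m (A^T *m x))]. *)
Lemma norm2_trmx_mul_le m n (A : 'M[R]_(m, n)) x :
  norm2 (A^T *m x) <= specnorm A * norm2 x.
Proof.
have [->|z0] := eqVneq (norm2 (A^T *m x)) 0.
  by rewrite mulr_ge0 ?specnorm_ge0 ?norm2_ge0.
have z1 : 0 < norm2 (A^T *m x) by rewrite lt_def z0 norm2_ge0.
rewrite -(ler_pM2l z1) -expr2 sqr_norm2 dot_adj trmxK.
apply: le_trans (dot_le_norm2 _ _) _.
have := ler_wpM2l (norm2_ge0 x) (norm2_mulmx_le A (A^T *m x)).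
by move/le_trans; apply; rewrite mulrC -mulrA mulrCA mulrA.
Qed.

Lemma kappa_ge0 m n (A : 'M[R]_(m, n)) : 0 <= kappa A.
Proof.
by apply: divr_ge0; [apply: sup_ge0 | apply: inf_ge0] => z [].
Qed.

Lemma gram_eigenvector m n (A : 'M[R]_(m, n)) t :
  eigenvalue (A^T *m A) t ->
  exists2 x, 0 < dot x x & dot (A *m x) (A *m x) = t * dot x x.
Proof.
case/eigenvalueP => v vt v0; exists v^T.
  by rewrite lt_def dotxx_eq0 trmx_eq0 v0 dotxx_ge0.
rewrite dot_adj mulmxA; have -> : A^T *m A *m v^T = t *: v^T.
  by apply: trmx_inj; rewrite !trmx_mul !trmxK vt linearZ /= trmxK.
by rewrite dotZr.
Qed.

(** The squares of the singular values lie between the extremal values of the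
    Rayleigh quotient of [A^T *m A], and these are themselves eigenvalues. The
    numbers [lo] and [hi] are the extreme singular values; [lo] is positive as
    [A] is injective, so that the quotient defining [kappa] is a true one. *)
Lemma kappa_bounds m n (A : 'M[R]_(m, n)) : (0 < n)%N -> mx_inj A ->
  exists lo hi, [/\ 0 < lo, 0 <= hi, kappa A = hi / lo,
    forall x, lo * norm2 x <= norm2 (A *m x) &
    forall x, norm2 (A *m x) <= hi * norm2 x].
Proof.
move=> n0 iA; pose G := A^T *m A.
have GT : G^T = G by rewrite trmx_mul trmxK.
have GE x : dot x (G *m x) = dot (A *m x) (A *m x) by rewrite dot_adj mulmxA.
have [h hG hP] := max_rayleigh_eigenvalue n0 GT.
have [l lG lP] := min_rayleigh_eigenvalue n0 GT.
have l0 : 0 < l.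
  have [x x0 xE] := gram_eigenvector lG.
  have : 0 < dot (A *m x) (A *m x).
    rewrite lt_def dotxx_ge0 andbT dotxx_eq0; apply/eqP => /iA x_0.
    by move: x0; rewrite x_0 /dot mulmx0 mxE ltxx.
  by rewrite xE pmulr_lgt0.
have h0 : 0 < h.
  have [x x0 xE] := gram_eigenvector lG.
  have := hP x; rewrite GE xE ler_pM2r // => /(lt_le_trans l0); exact.
have sv_sqrt t : 0 < t -> eigenvalue G t -> singular_values A (Num.sqrt t).
  by move=> t0 tG; split; rewrite ?sqrtr_ge0 // sqr_sqrtr // ltW.
have svP z : singular_values A z -> Num.sqrt l <= z <= Num.sqrt h.
  move=> [z0 /gram_eigenvector[x x0 xE]].
  have := hP x; have := lP x; rewrite GE xE !ler_pM2r // => lz zh.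
  by rewrite -[z]ger0_norm // -sqrtr_sqr !ler_wsqrtr.
exists (inf (singular_values A)), (sup (singular_values A)); rewrite /kappa.
have -> : inf (singular_values A) = Num.sqrt l.
  apply/eqP; rewrite eq_le; apply/andP; split.
    apply: ge_inf; last exact: sv_sqrt.
    by exists (Num.sqrt l) => z /svP/andP[].
  apply: lb_le_inf; first by exists (Num.sqrt l); apply: sv_sqrt.
  by move=> z /svP/andP[].
have -> : sup (singular_values A) = Num.sqrt h.
  apply/eqP; rewrite eq_le; apply/andP; split.
    apply: ge_sup; first by exists (Num.sqrt h); apply: sv_sqrt.
    by move=> z /svP/andP[].
  apply: ub_le_sup; last exact: sv_sqrt.
  by exists (Num.sqrt h) => z /svP/andP[].
split=> [|||x|x].
- by rewrite sqrtr_gt0.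
- exact: sqrtr_ge0.
- by [].
- rewrite -(@ler_pXn2r _ 2) ?nnegrE ?mulr_ge0 ?norm2_ge0 ?sqrtr_ge0 //.
  by rewrite exprMn !sqr_norm2 sqr_sqrtr ?(ltW l0) // -GE.
- by rewrite ler_norm2 ?sqrtr_ge0 // sqr_sqrtr ?(ltW h0) // -GE.
Qed.

(** * Absolute separation *)

(** By homogeneity the minimum over unit [Z] bounds every [Z]. The inverse of the
    separation is used rather than the separation so that the infinite case,
    where the only [Z] are of norm 0 and the inverse is 0, is covered too. *)
Lemma abssep_inverse p q (L1 : 'M[R]_p) (L2 : 'M[R]_q) :
  abssep L1 L2 != 0%E ->
  exists t, [/\ 0 <= t, ((abssep L1 L2)^-1 = t%:E)%E &
    forall Z, specnorm Z <= t * specnorm (L1 *m Z - Z *m L2)].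
Proof.
have lb Z : specnorm Z != 0 -> (abssep L1 L2 <=
    ((specnorm Z)^-1 * specnorm (L1 *m Z - Z *m L2))%:E)%E.
  move=> Z0; apply: (@le_trans _ _ (specnorm
      (L1 *m ((specnorm Z)^-1 *: Z) - (specnorm Z)^-1 *: Z *m L2))%:E).
    apply: ereal_inf_lbound; exists ((specnorm Z)^-1 *: Z) => //=.
    exact: specnorm_normalize.
  rewrite lee_fin -scalemxAl -scalemxAr -scalerBr.
  by rewrite specnorm_scale_le // invr_ge0 specnorm_ge0.
have ge0 : (0%E <= abssep L1 L2)%E.
  by apply/ereal_infP => _ [Z _ <-]; rewrite lee_fin specnorm_ge0.
case: (abssep L1 L2) lb ge0 => [a||] lb ge0 a0.
(* The separation is a positive real number [a]. *)
- rewrite eqe in a0; exists a^-1; split; rewrite ?invr_ge0 //.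
    by rewrite inver (negPf a0).
  move=> Z; have [->|Z0] := eqVneq (specnorm Z) 0.
    by rewrite mulr_ge0 ?invr_ge0 ?specnorm_ge0.
  have := lb Z Z0; rewrite lee_fin.
  have Zgt0 : 0 < specnorm Z by rewrite lt_def Z0 specnorm_ge0.
  have agt0 : 0 < a by rewrite lt_def a0.
  by rewrite ler_pdivlMl // ler_pdivlMl // mulrC.
(* A matrix of positive norm would make the separation finite. *)
- exists 0; split=> // Z; rewrite mul0r; have [->//|Z0] := eqVneq (specnorm Z) 0.
  by have := lb Z Z0; rewrite leye_eq.
- by [].
Qed.

(** * Distance between subspaces of equal dimension *)

Lemma mxrangeP m n (W : 'M[R]_(m, n)) u :
  u \in mxrange W -> exists c, u = W *m c.
Proof. by case/memv_imgP => c _ ->; exists c; rewrite lfunE. Qed.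

(** The distance is defined by projecting unit vectors of the first space on the
    second, while the hypothesis approximates vectors of the second space by
    the first: for equal dimensions the two are equivalent. If [r < 1], the
    orthogonal projection [P] onto the range of [Wa] is injective on the range
    of [Wb], hence maps it onto the range of [Wa]. A unit vector [u] of the
    latter is thus [P *m v], with [dot u v = 1]; if [N = dot v v], then
    [N - 1] is the squared distance of [v] to [u], so [N - 1 <= r ^+ 2 * N],
    and [N^-1 *: v] is at squared distance [1 - N^-1 <= r ^+ 2] of [u].
    If [1 <= r], the vector 0 is close enough. *)
Lemma subspace_dist_le n y (Wa Wb : 'M[R]_(n, y)) r :
  mx_inj Wa -> mx_inj Wb -> 0 <= r ->
  (forall c, exists d, norm2 (Wb *m c - Wa *m d) <= r * norm2 (Wb *m c)) ->
  subspace_dist (mxrange Wa) (mxrange Wb) <= r.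
Proof.
move=> iWa iWb r0 H; rewrite /subspace_dist.
suff near u : u \in mxrange Wa -> norm2 u = 1 ->
    exists2 v, v \in mxrange Wb & norm2 (u - v) <= r.
  set E := (X in sup X).
  have [[z Ez]|nE] := pselect (E !=set0)%classic; last first.
    by rewrite sup_out // => -[].
  apply: ge_sup; first by exists z.
  move=> _ [u [/= uU u1] <-]; have [v vV] := near u uU u1.
  apply: le_trans; apply: ge_inf; last by exists v.
  by exists 0 => _ [w _ <-]; apply: norm2_ge0.
move=> /mxrangeP[a ->] u1.
have [r1|r1] := leP 1 r.
  by exists 0; rewrite ?mem0v // subr0 u1.
have uH := gram_unit ((mx_inj_rank Wa).1 iWa).
set H1 := Wa^T *m Wa in uH.
pose P := Wa *m invmx H1 *m Wa^T.
have PT : P^T = P.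
  by rewrite !trmx_mul trmxK trmx_inv trmx_mul trmxK mulmxA.
have PWa : P *m Wa = Wa by rewrite -mulmxA -/H1 mulmxKV.
have PP : P *m P = P by rewrite {2}/P -mulmxA !mulmxA PWa.
have dotP v : dot (P *m v) (P *m v) = dot v (P *m v).
  by rewrite dot_adj PT mulmxA PP.
(* The left-hand side is the squared norm of [v - P *m v], where [v] is
   [Wb *m c]: the projection is the best approximation. *)
have bestP c : dot (Wb *m c) (Wb *m c) - dot (Wb *m c) (P *m (Wb *m c))
    <= r ^+ 2 * dot (Wb *m c) (Wb *m c).
  have [d] := H c; set v := Wb *m c; rewrite ler_norm2 //.
  apply: le_trans; set w := Wa *m d.
  have Pw : P *m w = w by rewrite mulmxA PWa.
  have := dotxx_ge0 (P *m v - w).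
  rewrite !(dotDl, dotDr, dotNl, dotNr) dotP (dotC w) (dotC w v).
  have -> : dot (P *m v) w = dot v w by rewrite dot_adj PT Pw.
  lra.
(* The matrix of the restriction of [P], in the bases [Wb] and [Wa]. *)
pose K := invmx H1 *m Wa^T *m Wb.
have PWb c : P *m (Wb *m c) = Wa *m (K *m c) by rewrite /P /K !mulmxA.
have uK : K \in unitmx.
  apply/unitmx_inj => c Kc; apply: iWb; apply/eqP; rewrite -dotxx_eq0.
  have := bestP c; rewrite PWb Kc mulmx0 {2}/dot mulmx0 [X in _ - X]mxE subr0.
  have := dotxx_ge0 (Wb *m c); set N := dot _ _ => N0 h.
  have r2 : 0 < 1 - r ^+ 2 by nra.
  by rewrite eq_le N0 andbT -(pmulr_lle0 _ r2); lra.
pose v := Wb *m (invmx K *m a).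
have Pv : P *m v = Wa *m a by rewrite PWb mulmxA mulmxV // mul1mx.
have uu : dot (Wa *m a) (Wa *m a) = 1 by rewrite -sqr_norm2 u1 expr1n.
have vu : dot v (Wa *m a) = 1 by rewrite -Pv -dotP Pv.
have := bestP (invmx K *m a); rewrite -/v Pv vu; set N := dot v v => hN.
have N1 : 1 <= N.
  have := dotxx_ge0 (v - Wa *m a).
  by rewrite !(dotDl, dotDr, dotNl, dotNr) uu (dotC _ v) vu -/N; lra.
have N0 : 0 < N by lra.
exists (N^-1 *: v); first by rewrite memvZ ?mxrange_mem.
rewrite -[r]mulr1 -u1 ler_norm2 // uu mulr1.
rewrite !(dotDl, dotDr, dotNl, dotNr, dotZl, dotZr) uu (dotC _ v) vu -/N.
have -> : 1 - N^-1 * 1 + (- (N^-1 * 1) - - (N^-1 * (N^-1 * N))) = (N - 1) / N.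
  by field; lra.
by rewrite ler_pdivrMr.
Qed.

End EuclideanNorm.

(** * Perturbation of the POD subspaces *)

(** The hypothesis [y <= s] makes the eigenbasis [row_mx V Vp] square, which
    turns its orthonormality into the resolution of the identity. *)
Lemma eigen_splitP (R : realType) s y (A : 'M[R]_s) V lam Vp lamp :
  (y <= s)%N -> @eigen_split R s y A V lam Vp lamp ->
  [/\ V^T *m V = 1%:M, Vp^T *m Vp = 1%:M, V *m V^T + Vp *m Vp^T = 1%:M,
      A *m V = V *m diag_mx lam & A *m Vp = Vp *m diag_mx lamp].
Proof.
move=> ys [QQ AQ _].
have QQ' : row_mx V Vp *m (row_mx V Vp)^T = 1%:M.
  have gen p (E : 'M[R]_(s, p)) : p = s -> E^T *m E = 1%:M -> E *m E^T = 1%:M.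
    by move=> e; subst p; exact: mulmx1C.
  by apply: gen QQ; rewrite subnKC.
move: QQ QQ'; rewrite tr_row_mx mul_col_row mul_row_col scalar_mx_block.
case/eq_block_mx => VV _ _ VpVp VVp.
move: AQ; rewrite diag_mx_row mul_mx_row mul_row_block !mulmx0 addr0 add0r.
by case/eq_row_mx.
Qed.

Lemma orthonormal_tr_norm2_le (R : realType) m n (V : 'M[R]_(m, n)) x :
  V^T *m V = 1%:M -> norm2 (V^T *m x) <= norm2 x.
Proof.
move=> VV; apply: le_trans (norm2_trmx_mul_le V x) _.
rewrite ler_piMl ?norm2_ge0 //; apply: specnorm_le => // z.
by rewrite mul1r orthonormal_norm2.
Qed.

(** An approximate invariant space [X] of [A] with residual [E *m X] has a
    component along the invariant space [Vp] that solves a Sylvester equation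
    with that residual: project the residual on [Vp] and use [Vp^T *m A =
    diag_mx L1 *m Vp^T]. *)
Lemma sylvester_projection (R : realType) s p q (A E : 'M[R]_s)
    (X : 'M[R]_(s, q)) (L2 : 'M[R]_q) (Vp : 'M[R]_(s, p)) (L1 : 'rV[R]_p) :
  A^T = A -> A *m Vp = Vp *m diag_mx L1 -> A *m X - X *m L2 = E *m X ->
  diag_mx L1 *m (Vp^T *m X) - Vp^T *m X *m L2 = Vp^T *m E *m X.
Proof.
move=> AT AV AX; rewrite -[RHS]mulmxA -AX mulmxBr !mulmxA; congr (_ *m _ - _).
by apply: trmx_inj; rewrite !trmx_mul trmxK AT AV tr_diag_mx.
Qed.

Lemma pod_gram_sym (R : realType) n s (Th : 'M[R]_n) (S : 'M[R]_(n, s)) g :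
  Th^T = Th -> (pod_gram Th S g)^T = pod_gram Th S g.
Proof. by move=> ThT; rewrite /pod_gram !trmx_mul trmxK !tr_diag_mx ThT !mulmxA. Qed.

(** In the coordinates given by [S *m Ga], the second POD space is spanned by
    [X], as [Ga *m X = Gb *m Vb]. The eigenvalue equation of the second Gram
    matrix turns [X *m diag_mx lamb] into [Gb *m Gb *m invmx Ga *m S^T *m Thb
    *m S *m Ga *m X], where [Gb *m Gb] is compared with [Ga *m Ga]; the
    diagonal matrices commute, whence the factors [Gb + Ga] and [Gb - Ga]. *)
Lemma pod_residual (R : realType) n s y (S : 'M[R]_(n, s)) (ga gb : 'rV[R]_s)
    (Thb Delta : 'M[R]_n) (Vb : 'M[R]_(s, y)) (lamb : 'rV[R]_y)
    (Ga := diag_mx ga) (Gb := diag_mx gb) (X := invmx Ga *m Gb *m Vb) :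
  Ga \in unitmx ->
  pod_gram Thb S gb *m Vb = Vb *m diag_mx lamb ->
  pod_gram (Thb + Delta) S ga *m X - X *m diag_mx lamb =
  ((S *m Ga)^T *m Delta *m (S *m Ga)
   - (Gb + Ga) *m (Gb - Ga) *m invmx Ga *m S^T *m Thb *m S *m Ga) *m X.
Proof.
move=> uGa AV.
have GaX : Ga *m X = Gb *m Vb by rewrite !mulmxA mulmxV // mul1mx.
have GC : Gb *m Ga = Ga *m Gb by exact: diag_mxC.
have GVC : invmx Ga *m Gb = Gb *m invmx Ga.
  by rewrite -[RHS](mulKmx uGa) (mulmxA Ga) -GC -(mulmxA Gb) mulmxV // mulmx1.
have XL : X *m diag_mx lamb = Gb *m Gb *m invmx Ga *m S^T *m Thb *m S *m Ga *m X.
  rewrite -[RHS]mulmxA GaX /X -(mulmxA _ Vb) -AV /pod_gram -/Gb !mulmxA GVC.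
  by rewrite -(mulmxA Gb) GVC !mulmxA.
have E : (Gb + Ga) *m (Gb - Ga) *m invmx Ga = Gb *m Gb *m invmx Ga - Ga.
  rewrite mulmxDl !mulmxBr GC addrA subrK mulmxBl -(mulmxA Ga Ga) mulmxV //.
  by rewrite mulmx1.
rewrite XL E; clearbody X; rewrite trmx_mul tr_diag_mx -/Ga /pod_gram -/Ga.
rewrite !(mulmxDr, mulmxDl, mulNmx) !mulmxA opprB addrA.
by rewrite [_ *m X + _]addrC.
Qed.

Theorem theorem3p5 (R : realType) (n s y : nat) (hys : (y <= s)%N)
    (S : 'M[R]_(n, s)) (ga gb : 'rV[R]_s) (Tha Thb Delta : 'M[R]_n)
    (Ua Ub : {vspace 'cV[R]_n})
    (Va Vb : 'M[R]_(s, y)) (lama lamb : 'rV[R]_y)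
    (Vaperp Vbperp : 'M[R]_(s, s - y)) (lamaperp lambperp : 'rV[R]_(s - y)) :
  let Ga := diag_mx ga in
  let Gb := diag_mx gb in
  psdmx Tha -> psdmx Thb -> Tha = Thb + Delta ->
  eigen_split (pod_gram Tha S ga) Va lama Vaperp lamaperp ->
  eigen_split (pod_gram Thb S gb) Vb lamb Vbperp lambperp ->
  (forall j, 0 < lama 0 j) -> (forall j, 0 < lamb 0 j) ->
  pod_minimizer y Tha S ga Ua -> Ua = mxrange (pod_basis S ga Va lama) ->
  pod_minimizer y Thb S gb Ub -> Ub = mxrange (pod_basis S gb Vb lamb) ->
  \rank (S *m Ga) = s ->
  abssep (diag_mx lamaperp) (diag_mx lamb) != 0%E ->
  ((subspace_dist Ua Ub)%:E <=
    (kappa (S *m Ga) * kappa (invmx Ga *m Gb *m Vb) *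
     (specnorm ((Gb + Ga) *m (Gb - Ga) *m invmx Ga *m S^T *m Thb *m S *m Ga)
      + specnorm Delta * specnorm (S *m Ga) ^+ 2))%:E
    / abssep (diag_mx lamaperp) (diag_mx lamb))%E.
Proof.
move=> Ga Gb [ThaT _] _ Thab eiga eigb lama0 lamb0 _ -> _ -> rM sep0.
have [t [t0 -> tP]] := abssep_inverse sep0.
have [VaVa VpVp VaVp AVa AVp] := eigen_splitP hys eiga.
have [VbVb _ _ AVb _] := eigen_splitP hys eigb.
set M := S *m Ga in rM *; set X := invmx Ga *m Gb *m Vb.
set E1 := (Gb + Ga) *m _ *m _ *m _ *m _ *m _ *m _.
set eta := specnorm E1 + _; rewrite -EFinM lee_fin.
have eta0 : 0 <= eta by rewrite addr_ge0 ?mulr_ge0 ?sqr_ge0 ?specnorm_ge0.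
have iM : mx_inj M by apply/mx_inj_rank.
have uGa : Ga \in unitmx.
  by apply/unitmx_inj => c Gc; apply: iM; rewrite -mulmxA Gc mulmx0.
(* The scaling of the POD bases by inverse square roots of eigenvalues does
   not change their ranges. *)
have sqrt_unit (lam : 'rV[R]_y) : (forall j, 0 < lam 0 j) ->
    diag_mx (\row_j (Num.sqrt (lam 0 j))^-1) \in unitmx.
  move=> lam0; rewrite unitmxE det_diag unitfE; apply/prodf_neq0 => j _.
  by rewrite mxE invr_eq0 sqrtr_eq0 -ltNge.
have uDa := sqrt_unit _ lama0; have uDb := sqrt_unit _ lamb0.
have iVa : mx_inj Va.
  by move=> c /(congr1 (mulmx Va^T)); rewrite mulmxA VaVa mul1mx mulmx0.
(* On the kernel of [Gb *m Vb] the Gram matrix of the second space vanishes,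
   but on the range of [Vb] it is invertible. *)
have iX : mx_inj X.
  have ulb : diag_mx lamb \in unitmx.
    by rewrite unitmxE det_diag unitfE; apply/prodf_neq0 => j _; rewrite gt_eqF.
  move=> c Xc; have GVc : Gb *m Vb *m c = 0.
    have := congr1 (mulmx Ga) Xc; rewrite mulmx0 => <-.
    by rewrite /X !mulmxA mulmxV // mul1mx.
  have : pod_gram Thb S gb *m Vb *m c = 0.
    by rewrite /pod_gram -!mulmxA (mulmxA _ Vb) GVc !mulmx0.
  rewrite AVb -mulmxA => /(congr1 (mulmx Vb^T)).
  rewrite mulmxA VbVb mul1mx mulmx0 => /(congr1 (mulmx (invmx (diag_mx lamb)))).
  by rewrite mulKmx // mulmx0.
have Wa_E : pod_basis S ga Va lama =
    M *m Va *m diag_mx (\row_j (Num.sqrt (lama 0 j))^-1) by [].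
have Wb_E : pod_basis S gb Vb lamb =
    M *m X *m diag_mx (\row_j (Num.sqrt (lamb 0 j))^-1).
  by rewrite /pod_basis -/Gb /M /X !mulmxA mulmxK.
rewrite {}Wa_E {}Wb_E.
set Da := diag_mx _ in uDa *; set Db := diag_mx _ in uDb *.
have AX : pod_gram Tha S ga *m X - X *m diag_mx lamb =
    (M^T *m Delta *m M - E1) *m X.
  by rewrite Thab; apply: pod_residual.
have ZE := sylvester_projection (pod_gram_sym S ga ThaT) AVp AX.
clearbody M X E1.
apply: subspace_dist_le.
- exact/mx_injM/unitmx_inj/uDa/mx_injM.
- exact/mx_injM/unitmx_inj/uDb/mx_injM.
- by do 3?[apply: mulr_ge0] => //; apply: kappa_ge0.
(* The vector [M *m X *m b] is approximated by [M *m Va *m Va^T *m X *m b];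
   the difference is the image under [M] of the part of [X *m b] along
   [Vaperp]. *)
move=> c; exists (invmx Da *m (Va^T *m X *m Db *m c)).
(* For [y = 0] there are no singular values, and [kappa_bounds] does not
   apply. *)
have [y0|y0] := posnP y.
  have -> : c = 0 by apply/colP => i; have := ltn_ord i; rewrite {2}y0.
  by rewrite !mulmx0 subr0 norm2_0 mulr0.
have s0 : (0 < s)%N := leq_trans y0 hys.
have [loM [hiM [loM0 hiM0 -> loMP hiMP]]] := kappa_bounds s0 iM.
have [loX [hiX [loX0 hiX0 -> loXP hiXP]]] := kappa_bounds y0 iX.
rewrite (mulmxA (M *m Va *m Da)) mulmxK // -!mulmxA; set b := Db *m c.
rewrite -mulmxBr; have -> : X *m b - Va *m (Va^T *m (X *m b)) =
    Vaperp *m (Vaperp^T *m X *m b).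
  rewrite -[X in X - _](mul1mx (X *m b)) -VaVp mulmxDl -!mulmxA.
  by rewrite addrC addKr.
have ZX : specnorm (Vaperp^T *m X) <= t * (eta * hiX).
  apply: le_trans (tP _) _; rewrite ZE; apply: ler_wpM2l => //.
  apply: specnorm_le => [|x]; first by rewrite mulr_ge0.
  rewrite -!mulmxA; apply: le_trans (orthonormal_tr_norm2_le _ VpVp) _.
  rewrite -mulrA; apply: le_trans (ler_wpM2l eta0 (hiXP x)).
  rewrite mulmxBl; apply: le_trans (norm2D _ _) _.
  rewrite norm2N addrC mulrDl lerD ?norm2_mulmx_le // -!mulmxA.
  apply: le_trans (norm2_trmx_mul_le _ _) _.
  rewrite [_ * _ ^+ 2]mulrC expr2 -!mulrA ler_wpM2l ?specnorm_ge0 //.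
  apply: le_trans (norm2_mulmx_le _ _) _.
  rewrite mulrCA ler_wpM2l ?specnorm_ge0 //; exact: norm2_mulmx_le.
apply: le_trans (hiMP _) _; rewrite orthonormal_norm2 //.
have h1 : norm2 (Vaperp^T *m X *m b) <= t * (eta * hiX) * norm2 b.
  by apply: le_trans (norm2_mulmx_le _ _) _; rewrite ler_wpM2r ?norm2_ge0.
have h2 : loM * (loX * norm2 b) <= norm2 (M *m (X *m b)).
  by apply: le_trans (loMP _); rewrite ler_wpM2l ?(ltW loM0).
apply: le_trans (ler_wpM2l hiM0 h1) _.
have -> : hiM * (t * (eta * hiX) * norm2 b) =
    hiM / loM * (hiX / loX) * eta * t * (loM * (loX * norm2 b)).
  by field; rewrite !gt_eqF.
by apply: ler_wpM2l => //; do 5?[apply: mulr_ge0] => //; rewrite invr_ge0 ltW.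
Qed.
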